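(* Let $G=(V,E)$ be a strongly connected $d$-out digraph, let $S=\langle R_1,\ldots,R_d\rangle$ be a coloring semigroup of $G$ with kernel $\mathcal K$, and let $\mathcal E$ be the equivalence relation on $V$ given by: $x\,\mathcal E\,y$ iff $x$ and $y$ lie in the same block of the partition induced by every element of $\mathcal K$ (equivalently, $\mathcal E=\bigcap_N \mathcal E_N$, where $N$ ranges over the minimal right ideals $N\mathcal K$ of $\mathcal K$ and $\mathcal E_N$ is the equivalence relation of the common partition $\Pi_N$ induced by the elements of $N\mathcal K$). Then for all $x,y\in V$, $x\,\mathcal E\,y$ if and only if $x\equiv_S y$.
   Context: A $d$-out digraph has every vertex of out-degree $d$ (multiple edges allowed). A coloring is a decomposition of the adjacency matrix $\mathcal A=R_1+\cdots+R_d$ into 0-1 stochastic matrices, each identified with a map $V\to V$ ($j R_i=k$ iff $(R_i)_{jk}=1$; maps act on the right). The coloring semigroup $S=\langle R_1,\ldots,R_d\rangle$ is the finite semigroup they generate under composition; its kernel $\mathcal K$ is its minimal ideal. Each $K\in\mathcal K$ induces the partition of $V$ into its nonempty fibers $\{i: iK=j\}$. The stability relation: $x\equiv_S y$ iff for every $W_1\in S$ there exists $W_2\in S$ with $xW_1W_2=yW_1W_2$. *)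

(* Defs.v *)
(* The vertex set is V = 'I_n.  A digraph with multiple edges is given by its
   adjacency matrix A: A j k is the number of edges from j to k.              *)
From mathcomp Require Import all_boot all_order all_algebra.

Set Implicit Arguments.
Unset Strict Implicit.
Unset Printing Implicit Defensive.

Section Digraph.

Variable n : nat.
Implicit Types A M : 'M[nat]_n.

Definition d_out d A := forall j, \sum_k A j k = d.

Definition strongly_connected A :=
  forall j k, connect [rel u v | 0 < A u v] j k.

Definition zero_one_stochastic M :=
  (forall j k, M j k = 0 \/ M j k = 1) /\ (forall j, \sum_k M j k = 1).

Definition is_coloring d A (R : 'I_d -> 'M[nat]_n) :=
  (forall i, zero_one_stochastic (R i)) /\ A = (\sum_i R i)%R.

(* The map j |-> k with M j k = 1; the default value j is never used when M is
   a 0-1 stochastic matrix.                                                   *)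
Definition mx_map M : {ffun 'I_n -> 'I_n} :=
  [ffun j => odflt j [pick k | M j k == 1]].

End Digraph.

Section TransformationSemigroup.

Variable V : finType.
Implicit Types (f g : {ffun V -> V}) (S T J N K : {set {ffun V -> V}}).
Implicit Type P : {set {set V}}.

(* Maps act on the right: f comes first in the product fg. *)
Definition compr f g : {ffun V -> V} := [ffun x => g (f x)].

Definition mul_closed T := compr @2: (T, T) \subset T.

Definition gen_semigroup T :=
  \bigcap_(S : {set {ffun V -> V}} | (T \subset S) && mul_closed S) S.

Definition ideal S J :=
  [&& J != set0, J \subset S,
      compr @2: (J, S) \subset J & compr @2: (S, J) \subset J].

Definition right_ideal S J :=
  [&& J != set0, J \subset S & compr @2: (J, S) \subset J].

Definition is_kernel S K := minset (ideal S) K.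

Definition minimal_right_ideal S N := minset (right_ideal S) N.

Definition induced_partition f := preim_partition f [set: V].

Definition same_block P x y := exists2 B, B \in P & (x \in B) /\ (y \in B).

Definition kernel_equiv K x y :=
  forall f, f \in K -> same_block (induced_partition f) x y.

(* The existential over P expresses that the elements of N all induce one and
   the same partition.                                                        *)
Definition common_partition_equiv N x y :=
  exists2 P, (forall f, f \in N -> induced_partition f = P) & same_block P x y.

Definition stable S x y :=
  forall W1, W1 \in S ->
    exists2 W2, W2 \in S & compr W1 W2 x = compr W1 W2 y.

End TransformationSemigroup.

Definition coloring_semigroup n d (R : 'I_d -> 'M[nat]_n) :=
  gen_semigroup [set mx_map (R i) | i : 'I_d].

(* Main.v *)
Require Import Defs.
From mathcomp Require Import all_boot all_order all_algebra.

(** All elements of the kernel have the same rank, since those of minimal rank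
    form an ideal.  Hence if [f] and [f g] both lie in the kernel then [g] is
    injective on the image of [f], i.e. [f] and [f g] have the same fibers.
    Stability gives [x f g = y f g] for some [g], hence [x f = y f]; minimal
    right ideals are treated in the same way, every minimal right ideal
    containing [f] being of the form [f K]. *)

Set Implicit Arguments.
Unset Strict Implicit.

Section Kernel.

Variable V : finType.
Implicit Types (f g : {ffun V -> V}) (S K : {set {ffun V -> V}}).

Lemma comprA f g h : compr f (compr g h) = compr (compr f g) h.
Proof. by apply/ffunP => x; rewrite !ffunE. Qed.

(** The blocks of a preimage partition are the fibers of the map; from here on, equality of values
    replaces membership in blocks. *)
Lemma same_block_induced f x y :
  same_block (induced_partition f) x y <-> f x = f y.
Proof.
have eqR : {in [set: V] & &, equivalence_rel [rel u v | f u == f v]}.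
  by move=> u v w _ _ _; split=> //= /eqP->.
have /and3P[/eqP cov tI _] := preim_partitionP f [set: V].
have mem_block u v : (v \in pblock (induced_partition f) u) = (f u == f v).
  exact: (pblock_equivalence_partition eqR (in_setT u) (in_setT v)).
split=> [[B BP [xB yB]]|fxy].
  by apply/eqP; rewrite -mem_block (def_pblock tI BP xB).
have xc : x \in cover (induced_partition f) by rewrite cov inE.
exists (pblock (induced_partition f) x); first exact: pblock_mem.
by rewrite !mem_block fxy.
Qed.

Lemma induced_partition_eq f g :
  (forall x y, f x = f y <-> g x = g y) ->
  induced_partition f = induced_partition g.
Proof.
move=> fg; apply: eq_imset => x; apply/setP => y; rewrite !inE.
by apply/eqP/eqP => /fg.
Qed.

Lemma kernel_equivP K x y :
  kernel_equiv K x y <-> forall f, f \in K -> f x = f y.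
Proof. by split=> xy f /xy /same_block_induced. Qed.

Definition rank f := #|f @: [set: V]|.

Lemma image_compr f g : compr f g @: [set: V] = g @: (f @: [set: V]).
Proof. by rewrite -imset_comp; apply: eq_imset => x; rewrite ffunE. Qed.

Lemma rank_comprl f g : rank (compr f g) <= rank f.
Proof. by rewrite /rank image_compr leq_imset_card. Qed.

Lemma rank_comprr f g : rank (compr f g) <= rank g.
Proof. by rewrite /rank image_compr subset_leq_card // imsetS ?subsetT. Qed.

(** Equal ranks mean that [g] maps the image of [f] onto a set of the same finite size, hence
    injectively. *)
Lemma rank_compr_fibers f g x y :
  rank (compr f g) = rank f -> (compr f g x = compr f g y <-> f x = f y).
Proof.
rewrite /rank image_compr => /eqP/imset_injP gI; rewrite !ffunE.
by split=> [/gI -> //|-> //]; apply: imset_f.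
Qed.

Lemma kernel_rank S K f g :
  is_kernel S K -> f \in K -> g \in K -> rank f = rank g.
Proof.
move=> /minsetP[/and4P[_ /subsetP KS /subsetP KrS /subsetP KlS] Kmin] fK gK.
have [m mK mmin] := @arg_minnP _ f [in K] rank fK.
(* Multiplication on either side never raises the rank, so [J] is an ideal of [S]; minimality of [K]
   then forces [J = K]. *)
pose J := [set h in K | rank h <= rank m].
have JK : J \subset K by apply/subsetP => h /setIdP[].
suff idJ : ideal S J.
  have rk h : h \in K -> rank h = rank m.
    move=> hK; apply/eqP; rewrite eqn_leq mmin // andbT.
    by move: hK; rewrite -{1}(Kmin J idJ JK) => /setIdP[].
  by rewrite !rk.
apply/and4P; split.
- by apply/set0Pn; exists m; apply/setIdP.
- by apply/subsetP => h /(subsetP JK)/KS.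
- apply/subsetP => _ /imset2P[h k /setIdP[hK hm] kS ->]; apply/setIdP; split.
    exact/KrS/imset2_f.
  exact: leq_trans (rank_comprl h k) hm.
- apply/subsetP => _ /imset2P[k h kS /setIdP[hK hm] ->]; apply/setIdP; split.
    exact/KlS/imset2_f.
  exact: leq_trans (rank_comprr k h) hm.
Qed.

Lemma kernel_compr_fibers S K f g x y :
  is_kernel S K -> f \in K -> g \in S ->
  (compr f g x = compr f g y <-> f x = f y).
Proof.
move=> kerK fK gS; apply: rank_compr_fibers.
have /minsetP[/and4P[_ _ KrS _] _] := kerK.
by apply: (kernel_rank kerK) => //; rewrite (subsetP KrS) ?imset2_f.
Qed.

Lemma kernel_equiv_stable S K x y :
  is_kernel S K -> kernel_equiv K x y <-> stable S x y.
Proof.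
move=> kerK.
have /minsetP[/and4P[/set0Pn[h hK] /subsetP KS _ /subsetP KlS] _] := kerK.
split=> [/kernel_equivP xy W1 W1S|xy].
  (* Any kernel element [h] serves as [W2], because [W1 h] lies in [K] again. *)
  by exists h; [exact: KS | apply/xy/KlS/imset2_f].
(* Stability is used with [W1 = f]; the factor [W2] is then cancelled. *)
apply/kernel_equivP => f fK; have [W2 W2S] := xy f (KS _ fK).
by move/(kernel_compr_fibers x y kerK fK W2S).
Qed.

(** Applied below with the kernel itself as the semigroup, to compare [f K] with minimal right
    ideals of [K]. *)
Lemma right_ideal_principal S f :
  S != set0 -> mul_closed S -> f \in S -> right_ideal S [set compr f g | g in S].
Proof.
move=> /set0Pn[h hS] /subsetP Scl fS; apply/and3P; split.
- by apply/set0Pn; exists (compr f h); apply: imset_f.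
- by apply/subsetP => _ /imsetP[g gS ->]; apply/Scl/imset2_f.
apply/subsetP => _ /imset2P[_ k /imsetP[g gS ->] kS ->].
by rewrite -comprA; apply/imset_f/Scl/imset2_f.
Qed.

Lemma kernel_equiv_common_partition S K x y :
  is_kernel S K ->
  kernel_equiv K x y <->
    forall N, minimal_right_ideal K N -> common_partition_equiv N x y.
Proof.
move=> kerK.
have /minsetP[/and4P[K0 /subsetP KS /subsetP KrS _] _] := kerK.
have Kcl : mul_closed K.
  apply/subsetP => _ /imset2P[f g fK gK ->].
  by apply/KrS/imset2_f => //; apply: KS.
split=> [/kernel_equivP xy N|xy].
  move=> /minsetP[/and3P[/set0Pn[f fN] /subsetP NK /subsetP NrK] Nmin].
  have fK := NK _ fN.
  exists (induced_partition f); last exact/same_block_induced/xy.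
  have fKN : [set compr f g | g in K] \subset N.
    by apply/subsetP => _ /imsetP[g gK ->]; apply/NrK/imset2_f.
  (* Minimality gives [N = f K], so [g] is some [f k] and has the fibers of [f]. *)
  move=> g; rewrite -(Nmin _ (right_ideal_principal K0 Kcl fK) fKN).
  move=> /imsetP[k kK ->]; apply: induced_partition_eq => u v.
  exact: kernel_compr_fibers kerK fK (KS _ kK).
apply/kernel_equivP => f fK.
(* It is not necessary to know that [f] lies in [N]: any [g] in [N] has the form [f k], and
   therefore the same fibers as [f]. *)
have [N minN /subsetP NfK] := minset_exists (right_ideal_principal K0 Kcl fK).
have [P NP] := xy N minN.
have /minsetP[/and3P[/set0Pn[g gN] _ _] _] := minN.
rewrite -(NP g gN) => /same_block_induced.
have /imsetP[k kK ->] := NfK _ gN.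
by move/(kernel_compr_fibers x y kerK fK (KS _ kK)).
Qed.

End Kernel.

Unset Implicit Arguments.

Theorem mainTheorem2 (n d : nat) (A : 'M[nat]_n) (R : 'I_d -> 'M[nat]_n)
    (K : {set {ffun 'I_n -> 'I_n}}) :
  d_out d A -> strongly_connected A -> is_coloring A R ->
  is_kernel (coloring_semigroup R) K ->
  forall x y : 'I_n,
    (kernel_equiv K x y <->
       forall N : {set {ffun 'I_n -> 'I_n}},
         minimal_right_ideal K N -> common_partition_equiv N x y) /\
    (kernel_equiv K x y <-> stable (coloring_semigroup R) x y).
Proof.
move=> _ _ _ kerK x y; split.
  exact: kernel_equiv_common_partition kerK.
exact: kernel_equiv_stable kerK.
Qed.
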